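(* Let $\chi$ be a finite or countable alphabet, let $\mu,\nu$ be stationary probability measures on $\chi^{\mathbb{N}}$, and suppose $\nu$ has complete grammar. Then the measure of the set of avoiding pairs is given by: (a) $\mathbb{P}(T_n^{(2)}=n)=1-\mathbb{E}_{\mu,\nu}(1)-a^{(2)}_{1,n}$ for every integer $n\ge2$. (b) $\displaystyle\lim_{n\to\infty}\mathbb{P}(T_n^{(2)}=n)=1-\mathbb{E}_{\mu,\nu}(1)-a^{(2)}_{1}$.
   Context: $\sigma$ is the left shift on $\chi^{\mathbb{N}}$, $\mathbb{N}=\{0,1,2,\dots\}$, and $x_m^n=x_mx_{m+1}\cdots x_n$. A string $\omega\in\chi^n$ is identified with the cylinder $\{\mathbf{x}\in\chi^{\mathbb{N}}: x_0^{n-1}=\omega\}$; $\mu\nu(\omega)=\mu(\omega)\nu(\omega)$. Stationary means $\sigma$-invariant, and $\mathbb{P}=\mu\times\nu$. The measure $\nu$ has complete grammar if $\nu(\omega)>0$ for all $n\ge1$ and all $\omega\in\chi^n$. Shortest-path function: $T_n^{(2)}(\mathbf{x},\mathbf{y})=\inf\{k\ge 1: y_0^{n-1}\cap\sigma^{-k}(x_0^{n-1})\ne\emptyset\}$. The set of avoiding pairs (of $n$-strings) is $\{(x_0^{n-1},y_0^{n-1})\in\chi^n\times\chi^n: T_n^{(2)}(\mathbf{x},\mathbf{y})=n\}$. Divergence: $\mathbb{E}_{\mu,\nu}(1)=\sum_{\omega\in\chi}\mu\nu(\omega)$. For $1\le j\le m-1$ let $R_m(j)=\{x_0^{m-1}\in\chi^m: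 x_{m-j}^{m-1}=x_0^{j-1}\}$. Then $$a^{(2)}_{1,n}=\sum_{m=2}^{n-1}\ \sum_{\omega\in\chi^m,\ \omega\notin\bigcup_{j=1}^{m-1}R_m(j)}\mu\nu(\omega)\quad(\text{so } a^{(2)}_{1,2}=0),\qquad a^{(2)}_{1}=\sum_{m=2}^{\infty}\ \sum_{\omega\in\chi^m,\ \omega\notin\bigcup_{j=1}^{m-1}R_m(j)}\mu\nu(\omega).$$ *)

(* Defs.v *)
From HB Require Import structures.
From mathcomp Require Import all_boot all_order all_algebra.
From mathcomp Require Import all_classical all_reals all_analysis.

Set Implicit Arguments.
Unset Strict Implicit.
Unset Printing Implicit Defensive.

Import Order.TTheory GRing.Theory Num.Theory.
Import numFieldNormedType.Exports.

Local Open Scope classical_set_scope.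
Local Open Scope ring_scope.
Local Open Scope ereal_scope.

(* A measurableType must be inhabited, so the alphabet is a pointedType; this
   loses nothing, because a probability measure exists on chi^nat only when chi
   is nonempty. *)

(* x_0^{n-1} *)
Definition block (chi : pointedType) (n : nat) (x : nat -> chi) : n.-tuple chi :=
  [tuple x i | i < n].

Definition cylinder (chi : pointedType) (n : nat) (w : n.-tuple chi) :
    set (nat -> chi) :=
  [set x | block n x = w].

Definition cylinders (chi : pointedType) : set (set (nat -> chi)) :=
  [set C | exists (n : nat) (w : n.-tuple chi), C = cylinder w].

(* chi^nat with the sigma-algebra generated by the cylinders; for a countable
   chi it is the product of the discrete sigma-algebras. *)
Definition seqspace (chi : pointedType) := g_sigma_algebraType (@cylinders chi).

HB.instance Definition _ (chi : pointedType) :=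
  Measurable.on (seqspace chi).

Definition left_shift (chi : pointedType) (x : nat -> chi) : nat -> chi :=
  fun i => x i.+1.

Definition stationary (R : realType) (chi : pointedType)
    (mu : probability (seqspace chi) R) : Prop :=
  forall A : set (seqspace chi), measurable A -> mu (@left_shift chi @^-1` A) = mu A.

Definition complete_grammar (R : realType) (chi : pointedType)
    (nu : probability (seqspace chi) R) : Prop :=
  forall n : nat, (1 <= n)%N -> forall w : n.-tuple chi, 0 < nu (cylinder w).

(* T_n^(2)(x, y), as an infimum in the extended reals. *)
Definition shortest_path (R : realType) (chi : pointedType) (n : nat)
    (x y : nat -> chi) : \bar R :=
  ereal_inf [set k%:R%:E | k in [set k : nat | (1 <= k)%N /\
    cylinder (block n y) `&` (iter k (@left_shift chi) @^-1` cylinder (block n x))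
      !=set0]].

(* The event T_n^(2) = n on pairs of sequences. *)
Definition avoiding (R : realType) (chi : pointedType) (n : nat) :
    set (seqspace chi * seqspace chi) :=
  [set xy | shortest_path R n xy.1 xy.2 = n%:R%:E].

Definition divergence1 (R : realType) (chi : pointedType)
    (mu nu : probability (seqspace chi) R) : \bar R :=
  \esum_(a in [set: chi]) (mu (cylinder [tuple a]) * nu (cylinder [tuple a])).

(* R_m(j): the last j letters coincide with the first j letters. *)
Definition self_overlap (chi : pointedType) (m j : nat) : set (m.-tuple chi) :=
  [set w | drop (m - j) w = take j w].

Definition unbordered (chi : pointedType) (m : nat) : set (m.-tuple chi) :=
  ~` \bigcup_(j in [set j : nat | (1 <= j <= m - 1)%N]) @self_overlap chi m j.

(* The inner sum over omega in chi^m of a_{1,n}^(2) and a_1^(2). *)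
Definition unbordered_mass (R : realType) (chi : pointedType)
    (mu nu : probability (seqspace chi) R) (m : nat) : \bar R :=
  \esum_(w in @unbordered chi m) (mu (cylinder w) * nu (cylinder w)).

Definition a1_upto (R : realType) (chi : pointedType)
    (mu nu : probability (seqspace chi) R) (n : nat) : \bar R :=
  \sum_(2 <= m < n) unbordered_mass mu nu m.

Definition a1 (R : realType) (chi : pointedType)
    (mu nu : probability (seqspace chi) R) : \bar R :=
  \sum_(2 <= m <oo) unbordered_mass mu nu m.

(* Main.v *)
(** The event T_n = n fails exactly when, for some 1 <= j < n, the last j letters
    of y_0^{n-1} agree with the first j letters of x.  For the least such j the
    common word is unbordered, since a border of it would be a shorter overlap;
    conversely an overlap along an unbordered word is the least one.  Hence the
    complement of the event is the disjoint union, over 1 <= j < n and over the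
    unbordered words w of length j, of the product sets [w] x sigma^{-(n-j)}[w],
    whose measures are mu(w) nu(w) because nu is stationary. *)
Require Import Defs.
From HB Require Import structures.
From mathcomp Require Import all_boot all_order all_algebra.
From mathcomp Require Import all_classical all_reals all_analysis.
From mathcomp Require Import zify.

Set Implicit Arguments.
Unset Strict Implicit.
Unset Printing Implicit Defensive.

Import Order.TTheory GRing.Theory Num.Theory.
Import numFieldNormedType.Exports.

Local Open Scope classical_set_scope.
Local Open Scope ring_scope.
Local Open Scope ereal_scope.

(** * Unions and additivity over a countable index set *)

Lemma countable_tuple (T : choiceType) (n : nat) (D : set (n.-tuple T)) :
  countable [set: T] -> countable D.
Proof.
move=> /countable_injP[f finj]; apply/countable_injP.
exists (fun w : n.-tuple T => pickle (map f w)) => v w _ _ /(pcan_inj pickleK).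
by move=> /inj_map/val_inj; apply => x y; apply: finj; rewrite inE.
Qed.

(** An injection [f] into [nat] regroups the union by the value of [f]; each fibre is empty or a
    single index. *)
Lemma countable_bigcup_measurable d (T : sigmaRingType d) (I : choiceType)
    (D : set I) (F : I -> set T) :
  countable D -> (forall i, D i -> measurable (F i)) ->
  measurable (\bigcup_(i in D) F i).
Proof.
move=> /countable_injP[f finj] mF.
have -> : \bigcup_(i in D) F i =
    \bigcup_n \bigcup_(i in D `&` f @^-1` [set n]) F i.
  rewrite predeqE => t; split => [[i Di Fit]|[n _ [i [Di _] Fit]]]; last first.
    by exists i.
  by exists (f i) => //; exists i.
apply: bigcup_measurable => n _.
have [[i [Di fi]]|nex] := pselect (exists i, D i /\ f i = n); last first.
  rewrite (_ : \bigcup_(i in _) _ = set0); first exact: measurable0.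
  by rewrite -subset0 => t [i [Di fi] _]; apply: nex; exists i.
rewrite (_ : _ `&` _ = [set i]) ?bigcup_set1; first exact: mF.
rewrite predeqE => j; split => [[Dj fj]|-> //].
by apply: finj; rewrite ?inE// fj fi.
Qed.

Lemma measure_countable_bigcup d (R : realType) (T : measurableType d)
    (m : {measure set T -> \bar R}) (I : choiceType) (D : set I) (F : I -> set T) :
  countable D -> (forall i, D i -> measurable (F i)) -> trivIset D F ->
  m (\bigcup_(i in D) F i) = \esum_(i in D) m (F i).
Proof.
move=> cD mF tF; have /countable_injP[f finj] := cD.
(* [G] transports the family along [f] to a family indexed by naturals, where sigma-additivity
   applies; the sum is then reindexed back along [f]. *)
pose G n := \bigcup_(i in D `&` f @^-1` [set n]) F i.
have GE i : D i -> G (f i) = F i.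
  move=> Di; rewrite /G (_ : _ `&` _ = [set i]) ?bigcup_set1//.
  rewrite predeqE => j; split => [[Dj fj]|-> //].
  by apply: finj; rewrite ?inE.
have -> : \bigcup_(i in D) F i = \bigcup_(n in f @` D) G n.
  by rewrite bigcup_image; apply: eq_bigcupr => i /GE.
rewrite measure_bigcup; first last.
- move=> _ _ [i Di <-] [j Dj <-]; rewrite !GE// => /(tF _ _ Di Dj).
  by move=> ->.
- by move=> _ [i Di <-]; rewrite GE//; exact: mF.
rewrite nneseries_esum//.
rewrite (_ : [set x | x \in f @` D] = f @` D); last first.
  by rewrite predeqE => n; split => /=; rewrite inE.
rewrite (reindex_esum D (f @` D) f); last by split => //; exact: finj.
by apply: eq_esum => i /GE ->.
Qed.

(** * Blocks, borders and overlaps, letter by letter *)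

Lemma iter_left_shift (chi : pointedType) k (x : nat -> chi) i :
  iter k (@left_shift chi) x i = x (k + i)%N.
Proof.
by elim: k i => // k IH i; rewrite iterS /left_shift IH addnS.
Qed.

Lemma blockP (chi : pointedType) n (x y : nat -> chi) :
  block n x = block n y <-> forall i, (i < n)%N -> x i = y i.
Proof.
split=> [xy i ilt|xy]; last by apply: eq_from_tnth => i; rewrite !tnth_mktuple xy.
by have := congr1 (fun t => tnth t (Ordinal ilt)) xy; rewrite !tnth_mktuple.
Qed.

Lemma nth_block (chi : pointedType) n (x : nat -> chi) a i :
  (i < n)%N -> nth a (block n x) i = x i.
Proof.
by move=> ilt; rewrite -(tnth_nth _ _ (Ordinal ilt)) tnth_mktuple.
Qed.

(** Padding with [point] turns any word into a block, so that [blockP] applies to it. *)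
Lemma block_surj (chi : pointedType) n (w : n.-tuple chi) :
  block n (nth point w) = w.
Proof. by apply: eq_from_tnth => i; rewrite tnth_mktuple -tnth_nth. Qed.

Lemma unborderedP (chi : pointedType) m (x : nat -> chi) :
  unbordered (block m x) <->
  forall j, (1 <= j < m)%N -> ~ forall i, (i < j)%N -> x (m - j + i)%N = x i.
Proof.
have ovP j : (j < m)%N -> self_overlap j (block m x) <->
    forall i, (i < j)%N -> x (m - j + i)%N = x i.
  move=> jm; rewrite /self_overlap/mkset; split => [e i ij|e].
    have := congr1 (fun s => nth point s i) e.
    by rewrite nth_drop nth_take// !nth_block//; lia.
  apply: (@eq_from_nth _ point).
    by rewrite size_drop size_take !size_tuple jm; lia.
  move=> i; rewrite size_drop size_tuple => ij.
  rewrite nth_drop nth_take; last by lia.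
  by rewrite !nth_block; [rewrite e//; lia|lia|lia].
split=> [ub j jm ov|ub [j /= jm /ovP ov]]; last first.
  by apply: (ub j); [lia|apply: ov; lia].
by apply: ub; exists j => /=; [lia|apply/ovP => //; lia].
Qed.

Definition suffix_prefix (chi : pointedType) (n j : nat) (x y : nat -> chi) :=
  forall i, (i < j)%N -> y (n - j + i)%N = x i.

(** The shift by [n] leaves no common position to check, so the infimum is at most [n]; a shift
    [k < n] is admissible exactly when there is an overlap of length [n - k]. *)
Lemma shortest_path_eqP (R : realType) (chi : pointedType) n (x y : nat -> chi) :
  (1 <= n)%N ->
  shortest_path R n x y = n%:R%:E <->
  forall j, (1 <= j < n)%N -> ~ suffix_prefix n j x y.
Proof.
move=> n1.
have SP k : cylinder (block n y) `&`
      (iter k (@left_shift chi) @^-1` cylinder (block n x)) !=set0 <->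
    forall i, (k + i < n)%N -> y (k + i)%N = x i.
  split=> [[z [/= /blockP zy /blockP zx]] i kin|yx].
    by rewrite -zy// -iter_left_shift zx//; lia.
  (* The witness follows [y] on its first [n] letters and the shifted copy of [x] afterwards; on the
     common positions the two agree by [yx]. *)
  exists (fun i => if (i < n)%N then y i else x (i - k)%N); split => /=.
    by apply/blockP => i ->.
  apply/blockP => i ilt; rewrite iter_left_shift.
  by case: ifPn => [/yx//|_]; rewrite addKn.
split=> [pn j jn ov|nov].
  have : shortest_path R n x y <= (n - j)%N%:R%:E.
    apply: ereal_inf_lbound; exists (n - j)%N => //; split; first by lia.
    by apply/SP => i ij; apply: ov; lia.
  by rewrite pn lee_fin ler_nat; lia.
apply/le_anti/andP; split.
  apply: ereal_inf_lbound; exists n => //; split=> //.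
  by apply/SP => i; lia.
apply: le_ereal_inf_tmp => _ [k [k1 /SP yx] <-].
rewrite lee_fin ler_nat leqNgt; apply/negP => kn.
apply: (nov (n - k)%N); first by lia.
by move=> i ik; rewrite subKn ?yx//; lia.
Qed.

(** * Decomposition of the complement of the event *)

Definition unbordered_overlap (chi : pointedType) (n j : nat) :
    set (seqspace chi * seqspace chi) :=
  \bigcup_(w in @unbordered chi j)
    (cylinder w `*` (iter (n - j) (@left_shift chi) @^-1` cylinder w)).

(** The first factor of each rectangle forces [w] to be the block of length [j] of the first
    sequence. *)
Lemma unbordered_overlapP (chi : pointedType) n j (xy : (nat -> chi) * (nat -> chi)) :
  @unbordered_overlap chi n j xy <->
  unbordered (block j xy.1) /\ suffix_prefix n j xy.1 xy.2.
Proof.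
have shE (x y : nat -> chi) :
    block j (iter (n - j) (@left_shift chi) y) = block j x <-> suffix_prefix n j x y.
  by rewrite blockP; split=> e i ij; have := e i ij; rewrite iter_left_shift.
case: xy => x y; split=> [[w uw [/= xw yw]]|[/= ub /shE sp]].
  by rewrite xw; split=> //; apply/shE; rewrite xw.
by exists (block j x).
Qed.

Lemma setC_avoiding (R : realType) (chi : pointedType) n : (1 <= n)%N ->
  ~` @avoiding R chi n =
  \bigcup_(j in [set j | (1 <= j < n)%N]) @unbordered_overlap chi n j.
Proof.
move=> n1; rewrite predeqE => -[x y]; split; last first.
  move=> [j /= jn /unbordered_overlapP[_ sp]].
  by move=> /(shortest_path_eqP _ _ _ n1)/(_ j jn); apply.
move=> nav; have ex : exists j, (1 <= j < n)%N && `[< suffix_prefix n j x y >].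
  apply: contrapT => nex; apply: nav; apply/shortest_path_eqP => // j jn sp.
  by apply: nex; exists j; rewrite jn; apply/asboolP.
case: (ex_minnP ex) => j /andP[jn /asboolP sp] jmin.
exists j => //; apply/unbordered_overlapP; split=> //=.
apply/unborderedP => i ij ov.
suff /jmin : (1 <= i < n)%N && `[< suffix_prefix n i x y >] by lia.
apply/andP; split; first by lia.
(* A border of length [i] gives $x_k = x_{j-i+k}$, and the overlap of length [j] turns this letter
   into $y_{n-i+k}$: an overlap shorter than the minimal one. *)
apply/asboolP => k ki; rewrite -ov// -sp; last by lia.
by congr y; lia.
Qed.

(** If overlaps of lengths [i < j] both occurred, the first [i] letters of [x] would also end its
    block of length [j], giving that block a border. *)
Lemma trivIset_unbordered_overlap (chi : pointedType) n :
  trivIset [set j | (1 <= j < n)%N] (@unbordered_overlap chi n).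
Proof.
have absurd i j : (1 <= i < j)%N -> (j < n)%N ->
    @unbordered_overlap chi n i `&` @unbordered_overlap chi n j !=set0 -> False.
  move=> ij jn [[x y] [/unbordered_overlapP[_ spi] /unbordered_overlapP[uj spj]]].
  move/unborderedP: uj => /(_ i ij); apply => k ki.
  rewrite -spj; last by lia.
  by rewrite -spi//; congr y; lia.
move=> i j /= i1 j1 ne; case: (ltngtP i j) => // ij.
  by exfalso; apply: (absurd i j) => //; lia.
by exfalso; apply: (absurd j i); [lia|lia|rewrite setIC].
Qed.

(** * Measurability and invariance under iterated shifts *)

Lemma measurable_cylinder (chi : pointedType) n (w : n.-tuple chi) :
  measurable (cylinder w : set (seqspace chi)).
Proof. by apply: sub_sigma_algebra; exists n, w. Qed.

Lemma left_shift_preimage_cylinder (chi : pointedType) n (w : n.-tuple chi) :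
  @left_shift chi @^-1` cylinder w = \bigcup_a cylinder (cons_tuple a w).
Proof.
rewrite predeqE => x; split => [xw|[a _ xaw]].
  exists (x 0%N) => //; apply: eq_from_tnth => i; rewrite tnth_mktuple.
  by rewrite -[w]xw; case: (unliftP ord0 i) => [k ->|->] /=; rewrite ?tnthS ?tnth_mktuple.
rewrite /cylinder/= -(block_surj w); apply/blockP => i ilt.
have <- : nth point (cons_tuple a w) i.+1 = nth point w i by [].
by rewrite -xaw nth_block.
Qed.

(** It suffices to test generating cylinders; the preimage of one leaves the first letter free,
    hence is a union of cylinders indexed by the countable alphabet. *)
Lemma measurable_left_shift (chi : pointedType) : countable [set: chi] ->
  measurable_fun setT (@left_shift chi : seqspace chi -> seqspace chi).
Proof.
move=> cchi; apply: (@measurability _ _ (seqspace chi) (seqspace chi) setT _ (@cylinders chi)) => //.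
move=> _ [_ [n [w ->]] <-]; rewrite setTI left_shift_preimage_cylinder.
by apply: countable_bigcup_measurable => // a _; exact: measurable_cylinder.
Qed.

Lemma measurable_iter_left_shift (chi : pointedType) k : countable [set: chi] ->
  measurable_fun setT (iter k (@left_shift chi) : seqspace chi -> seqspace chi).
Proof.
move=> cchi; elim: k => [|k IH]; first exact: measurable_id.
exact: measurableT_comp (measurable_left_shift cchi) IH.
Qed.

Lemma measurable_iter_left_shift_preimage (chi : pointedType) k
    (A : set (seqspace chi)) : countable [set: chi] -> measurable A ->
  measurable (iter k (@left_shift chi) @^-1` A : set (seqspace chi)).
Proof.
move=> cchi mA; rewrite -[X in measurable X]setTI.
exact: (measurable_iter_left_shift k cchi measurableT).
Qed.

Lemma stationary_iter (R : realType) (chi : pointedType)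
    (nu : probability (seqspace chi) R) k (A : set (seqspace chi)) :
  countable [set: chi] -> stationary nu -> measurable A ->
  nu (iter k (@left_shift chi) @^-1` A) = nu A.
Proof.
move=> cchi st mA; elim: k => // k IH.
(* The single shift is made the outer preimage, so that stationarity applies to the measurable set
   given by the first [k] shifts. *)
rewrite (_ : _ @^-1` A =
    @left_shift chi @^-1` (iter k (@left_shift chi) @^-1` A)).
  by rewrite st//; exact: measurable_iter_left_shift_preimage.
by rewrite predeqE => x; rewrite /preimage/= -iterSr.
Qed.

(** * Measures of the pieces and of their union *)

Section unbordered_overlap_measure.
Context (R : realType) (chi : pointedType).
Context (mu nu : probability (seqspace chi) R).
Hypothesis chi_countable : countable [set: chi].

Lemma measurable_overlap_word n j (w : j.-tuple chi) :
  measurable (cylinder w `*` (iter (n - j) (@left_shift chi) @^-1` cylinder w)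
    : set (seqspace chi * seqspace chi)).
Proof.
apply: measurableX; first exact: measurable_cylinder.
by apply: measurable_iter_left_shift_preimage => //; exact: measurable_cylinder.
Qed.

Lemma measurable_unbordered_overlap n j : measurable (@unbordered_overlap chi n j).
Proof.
apply: countable_bigcup_measurable; first exact: countable_tuple.
by move=> w _; exact: measurable_overlap_word.
Qed.

Lemma measure_unbordered_overlap n j : stationary nu ->
  (mu \x nu) (@unbordered_overlap chi n j) = unbordered_mass mu nu j.
Proof.
move=> st; rewrite measure_countable_bigcup; first last.
(* The rectangles of distinct words are disjoint, since the first sequence determines the word. *)
- by move=> v w _ _ [xy [[/= <- _] [/= <- _]]].
- by move=> w _; exact: measurable_overlap_word.
- exact: countable_tuple.
apply: eq_esum => w _; have mw := measurable_cylinder w.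
rewrite [LHS]product_measure1E//; first by congr (_ * _); exact: stationary_iter.
exact: measurable_iter_left_shift_preimage.
Qed.

Lemma unbordered_mass_ge0 j : 0 <= unbordered_mass mu nu j.
Proof. by apply: esum_ge0 => w _; rewrite mule_ge0. Qed.

(** A one-letter word has no proper border, so the pieces of length 1 account for the divergence
    term. *)
Lemma unbordered_mass1 : unbordered_mass mu nu 1 = divergence1 mu nu.
Proof.
rewrite /unbordered_mass /divergence1.
rewrite (reindex_esum [set: chi] (@unbordered chi 1) (fun a => [tuple a]))//.
split=> [a _|a b _ _ [//]|w _].
  by case=> j /=; lia.
by exists (thead w) => //; apply: eq_from_tnth => i; rewrite (ord1 i).
Qed.

Lemma measure_setC_avoiding n : stationary nu -> (2 <= n)%N ->
  (mu \x nu) (~` @avoiding R chi n) = divergence1 mu nu + a1_upto mu nu n.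
Proof.
move=> st n2; rewrite setC_avoiding; last by lia.
rewrite measure_bigcup; first last.
- exact: trivIset_unbordered_overlap.
- by move=> j _; exact: measurable_unbordered_overlap.
rewrite (eq_eseriesr (fun j _ => measure_unbordered_overlap n j st)).
(* The series is cut at [n], beyond which no index satisfies the condition. Index 0 is then
   discarded, and index 1 supplies [divergence1]. *)
rewrite (@nneseries_split_cond _ _ 0 n); last first.
  by move=> *; exact: unbordered_mass_ge0.
rewrite [X in _ + X]eseries0 ?adde0; last first.
  by move=> j nj; rewrite inE/= => jn; exfalso; lia.
rewrite add0n -unbordered_mass1 /a1_upto -big_ltn//.
rewrite [LHS]big_ltn_cond; last by lia.
rewrite ifF; last by apply/negbTE; rewrite notin_setE.
rewrite big_nat_cond [RHS]big_nat; apply: eq_bigl => j.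
apply/andP/idP => [[//]|jn]; split=> //.
by rewrite inE.
Qed.

Lemma measurable_avoiding n : (1 <= n)%N -> measurable (@avoiding R chi n).
Proof.
move=> n1; rewrite -[X in measurable X]setCK setC_avoiding//.
apply: measurableC; apply: bigcup_measurable => j _.
exact: measurable_unbordered_overlap.
Qed.

End unbordered_overlap_measure.

Theorem corollary5p1 (R : realType) (chi : pointedType)
    (chi_countable : countable [set: chi])
    (mu nu : probability (seqspace chi) R)
    (mu_stationary : stationary mu) (nu_stationary : stationary nu)
    (nu_complete : complete_grammar nu) :
  (forall n : nat, (2 <= n)%N ->
     (mu \x nu) (@avoiding R chi n) = 1 - divergence1 mu nu - a1_upto mu nu n)
  /\
  (fun n : nat => (mu \x nu) (@avoiding R chi n)) @ \oo -->
    1 - divergence1 mu nu - a1 mu nu.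
Proof.
have u0 := unbordered_mass_ge0 mu nu.
have d0 : 0 <= divergence1 mu nu by rewrite -unbordered_mass1.
have up0 n : 0 <= a1_upto mu nu n by exact: sume_ge0.
(* Being the probability of the complement, the sum is at most 1; this yields the finiteness that
   subtraction in the extended reals requires. *)
have sum_le1 n : (2 <= n)%N -> divergence1 mu nu + a1_upto mu nu n <= 1.
  move=> n2; rewrite -measure_setC_avoiding//.
  apply: probability_le1; apply: measurableC.
  by apply: measurable_avoiding => //; lia.
have up_le1 n : a1_upto mu nu n <= 1.
  have [n2|n2] := leqP 2 n; last by rewrite /a1_upto big_geq//; lia.
  by apply: le_trans (sum_le1 n n2); rewrite leeDr.
have upcvg : a1_upto mu nu n @[n --> \oo] --> a1 mu nu.
  by apply: is_cvg_nneseries => *.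
(* The bound by 1 on the partial sums passes to the limit. *)
have afin : a1 mu nu \is a fin_num.
  rewrite ge0_fin_numE; last by apply: nneseries_ge0.
  apply: le_lt_trans (ltry 1).
  apply: lime_le; first by apply: is_cvg_nneseries.
  exact: nearW.
have formula n : (2 <= n)%N ->
    (mu \x nu) (@avoiding R chi n) = 1 - divergence1 mu nu - a1_upto mu nu n.
  move=> n2.
  rewrite -[@avoiding R chi n]setCK [LHS]probability_setC; last first.
    by apply: measurableC; apply: measurable_avoiding => //; lia.
  (* Merging the two subtractions into one is legitimate because [a1_upto] is finite by [up_le1]. *)
  rewrite -addeA -fin_num_oppeD; last first.
    by rewrite ge0_fin_numE//; apply: le_lt_trans (ltry 1).
  by rewrite -(measure_setC_avoiding mu chi_countable nu_stationary n2).
split=> //.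
(* The formula holds only from [n = 2] on, so the limit is computed on its right-hand side and
   transferred by eventual equality. *)
apply: cvg_trans; last first.
  apply: (@cvgeB _ _ _ _ (fun=> 1 - divergence1 mu nu) (a1_upto mu nu)
     (1 - divergence1 mu nu) (a1 mu nu)) upcvg; last exact: cvg_cst.
  by rewrite fin_num_adde_defl// fin_numN.
by apply: near_eq_cvg; exists 2%N => // n /= /formula.
Qed.
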